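(* For every partition $\lambda$, in infinitely many variables $x=(x_1,x_2,\dots)$, \[\mathrm{ss}_\lambda(x)=\prod_{i<j}(1-x_ix_j)^{-1}\, s_\lambda(x),\] where $s_\lambda$ is the Schur function.
   Context: Partitions are Young diagrams; a skew shape is a horizontal strip if it has at most one box in each column. An SSOT of shape $\lambda$ is a sequence of partitions $S=(S^1,S'^2,S^2,S'^3,\dots)$ such that, with $S^0=S'^1=\emptyset$: for all $i\ge1$, $S'^i\subseteq S^{i-1}$, $S'^i\subseteq S^i$, and $S^{i-1}/S'^i$, $S^i/S'^i$ are horizontal strips (possibly empty); and $S^i=S'^{i+1}=\lambda$ for all large $i$. Put $m_i(S)=|S^{i-1}/S'^i|+|S^i/S'^i|$, length $n=\sum_i m_i(S)$, $x^S=\prod_ix_i^{m_i(S)}$. $\mathrm{ss}_{\lambda,n}(x)=\sum x^S$ over SSOTs of shape $\lambda$ and length $n$, and the full SSOT function is $\mathrm{ss}_\lambda(x)=\sum_{n\ge0}\mathrm{ss}_{\lambda,n}(x)$, a formal power series. *)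

(* Defs.v *)
From HB Require Import structures.
From mathcomp Require Import all_boot all_order all_algebra finmap multiset.
From mathcomp Require Import mathcomp_extra boolp classical_sets functions.
From mathcomp Require Import cardinality fsbigop.

Set Implicit Arguments.
Unset Strict Implicit.
Unset Printing Implicit Defensive.

Import GRing.Theory.

Local Open Scope classical_set_scope.
Local Open Scope nat_scope.

(* The variables are indexed from 0: index [i] stands for x_(i+1). A monomial is
   the multiset of its variables, so [m i] is the exponent of variable [i]. *)
Definition monom := {mset nat}%mset.

(* The ring structure that MathComp-Analysis puts on functions is the pointwise
   one, so the Cauchy product below is deliberately not written [*]. *)
Definition fps := monom -> int.

Definition fps_monom (a : monom) : fps := fun m => (m == a)%:R%R.

Definition fps_one : fps := fps_monom mset0.

Definition fps_var (i : nat) : fps := fps_monom [mset i]%mset.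

Definition fps_sub (f g : fps) : fps := fun m => (f m - g m)%R.

Definition fps_mul (f g : fps) : fps := fun m =>
  (\sum_(p \in [set p : monom * monom | (p.1 `+` p.2)%mset = m]) f p.1 * g p.2)%R.

Definition fps_inv (f : fps) : fps :=
  xget fps_one [set g : fps | fps_mul f g = fps_one].

(* Sum of a family of power series in which every monomial occurs in only
   finitely many members: [\sum_(_ \in _)] ranges over the finite support. *)
Definition fps_sum (I : choiceType) (A : set I) (F : I -> fps) : fps :=
  fun m => (\sum_(i \in A) F i m)%R.

(* Unordered infinite product: each coefficient is the value at which the
   coefficients of the finite partial products stabilize. *)
Definition fps_prod (I : choiceType) (A : set I) (F : I -> fps) : fps :=
  fun m => xget 0%R [set c : int |
    exists2 B0 : {fset I}, [set` B0] `<=` A &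
      forall B : {fset I}, [set` B0] `<=` [set` B] -> [set` B] `<=` A ->
        (\big[fps_mul/fps_one]_(i <- B) F i) m = c].

Definition is_partition (s : seq nat) : bool := sorted geq s && (0 \notin s).

Record intpart := IntPart {
  parts :> seq nat;
  _ : is_partition parts
}.

HB.instance Definition _ := [isSub for parts].
HB.instance Definition _ := [Choice of intpart by <:].

Definition empty_partition : intpart := @IntPart [::] isT.

(* Rows and columns are numbered from 0. *)
Definition part (lam : intpart) (r : nat) : nat := nth 0 lam r.

Definition diagram (lam : intpart) : set (nat * nat) :=
  [set b | b.2 < part lam b.1].

Definition part_sub (mu lam : intpart) : Prop := diagram mu `<=` diagram lam.

Definition skew_diagram (lam mu : intpart) : set (nat * nat) :=
  diagram lam `\` diagram mu.

Definition horizontal_strip (lam mu : intpart) : Prop :=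
  forall r r' c, skew_diagram lam mu (r, c) -> skew_diagram lam mu (r', c) ->
    r = r'.

Definition skew_size (lam mu : intpart) : nat :=
  \sum_(r < size lam) (part lam r - part mu r).

(* A tableau is the list of its rows, its entries being variable indices. *)
Definition is_ssyt (lam : intpart) (T : seq (seq nat)) : Prop :=
  [/\ shape T = lam,
      all (sorted leq) T
    & forall r c, c < size (nth [::] T r.+1) ->
        nth 0 (nth [::] T r) c < nth 0 (nth [::] T r.+1) c].

Definition schur (lam : intpart) : fps :=
  fps_sum [set T | is_ssyt lam T] (fun T => fps_monom (seq_mset (flatten T))).

(* [S = (S.1, S.2)] encodes (S^1, S'^2, S^2, ...) with [S.1 i] = S^i and
   [S.2 i] = S'^(i+1); the conventional S^0 and S'^1 are stored at index 0. *)
Definition ssot_seq : choiceType :=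
  ((nat -> intpart) * (nat -> intpart))%type.

Definition is_ssot (lam : intpart) (S : ssot_seq) : Prop :=
  [/\ S.1 0 = empty_partition /\ S.2 0 = empty_partition,
      forall i, part_sub (S.2 i) (S.1 i) /\ part_sub (S.2 i) (S.1 i.+1),
      forall i, horizontal_strip (S.1 i) (S.2 i)
                /\ horizontal_strip (S.1 i.+1) (S.2 i)
    & exists N, forall i, N <= i -> S.1 i = lam /\ S.2 i = lam].

(* m_(i+1)(S), the exponent of variable [i]. *)
Definition ssot_mult (S : ssot_seq) (i : nat) : nat :=
  skew_size (S.1 i) (S.2 i) + skew_size (S.1 i.+1) (S.2 i).

Definition ssot_length (S : ssot_seq) : nat :=
  \big[addn/0]_(i \in [set: nat]) ssot_mult S i.

Definition ssot_monom (S : ssot_seq) : fps :=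
  fun m => `[< forall i, m i = ssot_mult S i >]%:R%R.

Definition ss_n (lam : intpart) (n : nat) : fps :=
  fps_sum [set S | is_ssot lam S /\ ssot_length S = n] ssot_monom.

Definition ss (lam : intpart) : fps := fps_sum [set: nat] (ss_n lam).

(* Main.v *)
From HB Require Import structures.
Require Import Defs.
From mathcomp Require Import all_boot all_order all_algebra finmap multiset.
From mathcomp Require Import boolp classical_sets functions cardinality fsbigop.
From mathcomp Require Import zify.

(** Order the variables x_0, x_1, ...; an SSOT in x_0, ..., x_k ending in lam is
    an SSOT in x_0, ..., x_(k-1) ending in some nu, followed by the removal of a
    horizontal strip (nu to alpha) and the addition of another (alpha to lam),
    both weighted by x_k.  By induction the former are equidistributed with
    pairs (exponents of the factors 1/(1 - x_i x_j), i < j < k; tableau of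
    shape nu), so it remains to move the removal operator D(x_k) through the
    additions U(x_(k-1)) ... U(x_0) that build the tableau.  Each commutation
    D(y) U(z) = (1 - y z)^-1 U(z) D(y) comes from a weight-preserving bijection
    (a growth-diagram local rule); D(x_k) finally fixes the empty partition.
    This leaves the factors 1/(1 - x_i x_k), i < k, and a tableau of shape
    alpha, which the strip lam/alpha extends to a tableau of shape lam.  A monomial involves finitely many variables, so the identity in
    infinitely many variables is checked with k large. *)

Set Implicit Arguments.
Unset Strict Implicit.
Unset Printing Implicit Defensive.

Import GRing.Theory.
Local Open Scope classical_set_scope.
Local Open Scope ring_scope.

(** * Power series *)

(** The dependent double sum is made rectangular: every [B i] lies in the finite union [U], and [G]
    pads [F] with [idx] outside [B i]. *)
Lemma fsbig_sigma (R : Type) (idx : R) (op : Monoid.com_law idx)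
    (I J : choiceType) (A : set I) (B : I -> set J) (F : I -> J -> R) :
  finite_set A -> (forall i, A i -> finite_set (B i)) ->
  \big[op/idx]_(i \in A) \big[op/idx]_(j \in B i) F i j =
  \big[op/idx]_(p \in [set p | A p.1 /\ B p.1 p.2]) F p.1 p.2.
Proof.
move=> finA finB.
pose U := \bigcup_(i in A) B i.
have finU : finite_set U by exact: bigcup_finite.
pose G i j := if j \in B i then F i j else idx.
transitivity (\big[op/idx]_(i \in A) \big[op/idx]_(j \in U) G i j).
  apply: eq_fsbigr => i /set_mem Ai.
  rewrite -fsbig_mkcondr; apply: eq_fsbigl; apply/seteqP; split=> j /=; last by case.
  by move=> Bij; split=> //; exists i.
rewrite pair_fsbig//.
transitivity (\big[op/idx]_(p \in [set p | A p.1 /\ B p.1 p.2]) G p.1 p.2).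
  apply/esym/fsbig_widen.
    by move=> [i j] /= [Ai Bij]; split=> //; exists i.
  move=> [i j] /= [[Ai _]] nB; rewrite /G ifF//; apply/negbTE/negP => /set_mem Bij.
  exact: nB.
by apply: eq_fsbigr => -[i j] /set_mem /= [_ Bij]; rewrite /G ifT// inE.
Qed.

Definition splits (m : monom) : set (monom * monom) :=
  [set p | (p.1 `+` p.2)%mset = m].

Lemma finite_msubset (m : monom) : finite_set [set a : monom | (a `<=` m)%mset].
Proof.
rewrite -(seq_mset_id m); elim: (enum_mset _) => [|x s IH].
  apply: (@sub_finite_set _ _ [set mset0]); last exact: finite_set1.
  move=> a /=; rewrite (_ : seq_mset [::] = mset0); first by rewrite msubset0 => /eqP.
  by apply/msetP => y; rewrite mset_seqE mset0E.
(* A submultiset of the enlarged multiset either contains [x], and is then [x] added to a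
   submultiset of the multiset of [s], or is itself such a submultiset. *)
apply: (@sub_finite_set _ _
  ([set a | (a `<=` seq_mset s)%mset] `|`
   [set (x +` a)%mset | a in [set a | (a `<=` seq_mset s)%mset]])).
  move=> a /=; rewrite mset_cons => /msubsetP am.
  have [xa|xa] := boolP (x \in a); [right|left].
    exists (a `\ x)%mset; last by rewrite msetB1K.
    by apply/msubsetP => y; have := am y; rewrite !mset1DE msetB1E; case: eqP => _ /=; lia.
  apply/msubsetP => y; have := am y; rewrite mset1DE.
  by case: eqP => [->|//]; move: xa; rewrite -mset_neq0 negbK => /eqP ->.
by rewrite finite_setU; split=> //; exact: finite_image.
Qed.

Lemma finite_splits m : finite_set (splits m).
Proof.
apply: (@sub_finite_set _ _ ([set a | (a `<=` m)%mset] `*` [set a | (a `<=` m)%mset])).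
  by move=> [a b] /= <-; split=> /=; apply/msubsetP => x; rewrite msetE2 ?leq_addr ?leq_addl.
by apply: finite_setX; exact: finite_msubset.
Qed.

Lemma fps_mulC : commutative fps_mul.
Proof.
move=> f g; apply/funext => m; rewrite /fps_mul.
rewrite (@reindex_fsbig _ _ _ _ _ (fun p => (p.2, p.1)) (splits m)).
  by apply: eq_fsbigr => p _ /=; rewrite mulrC.
split.
- by move=> [a b] /= <-; rewrite msetDC.
- by move=> [a b] [c d] _ _ /= [-> ->].
- by move=> [a b] /= <-; exists (b, a) => //=; rewrite /splits /= msetDC.
Qed.

Lemma fps_mul1 : left_id fps_one fps_mul.
Proof.
move=> f; apply/funext => m; rewrite /fps_mul.
rewrite -(@fsbig_widen _ _ _ _ [set (mset0, m)] (splits m)) ?fsbig_set1 /=.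
- by rewrite /fps_one /fps_monom eqxx mul1r.
- by move=> _ ->; exact: mset0D.
- move=> [a b] /= [abm abN]; rewrite /fps_one /fps_monom.
  case: eqP => [a0|_]; last by rewrite mul0r.
  by exfalso; apply: abN; rewrite -abm a0 mset0D.
Qed.

Lemma fps_mulA : associative fps_mul.
Proof.
move=> f g h; apply/funext => m; rewrite /fps_mul.
under eq_fsbigr do rewrite mulr_fsumr.
under [RHS]eq_fsbigr do rewrite mulr_fsuml.
rewrite !fsbig_sigma; try exact: finite_splits; try by move=> *; exact: finite_splits.
(* Both sides range over three-fold splittings of [m]; the reindexing rebrackets (c + d) + b as c +
   (d + b). *)
rewrite (@reindex_fsbig _ _ _ _ _ (fun p => ((p.2.1, (p.2.2 `+` p.1.2)%mset), (p.2.2, p.1.2)))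
  [set p : (monom * monom) * (monom * monom) | splits m p.1 /\ splits p.1.1 p.2]).
  by apply: eq_fsbigr => p _ /=; rewrite mulrA.
split.
- by move=> [[a b] [c d]] /= [<- <-]; split=> //; rewrite /splits /= msetDA.
- move=> [[a b] [c d]] [[a' b'] [c' d']] /set_mem /= [_ ab] /set_mem /= [_ ab'].
  by move=> [cc _ dd bb]; move: ab ab'; rewrite /splits /= cc dd bb => <- <-.
- move=> [[a b] [c d]] /= [<- <-].
  by exists (((a `+` c)%mset, d), (a, c)) => //=; split=> //; rewrite /splits /= msetDA.
Qed.

Lemma fps_mulBl f g h : fps_mul (fps_sub f g) h = fps_sub (fps_mul f h) (fps_mul g h).
Proof.
apply/funext => m; rewrite /fps_sub /fps_mul !fsbig_finite; try exact: finite_splits.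
by rewrite -sumrB; apply: eq_bigr => p _; rewrite mulrBl.
Qed.

HB.instance Definition _ := Monoid.isComLaw.Build fps fps_one fps_mul
  fps_mulA fps_mulC fps_mul1.

(** * Generating functions of weighted sets *)

Definition gf (I : choiceType) (A : set I) (w : I -> monom) : fps :=
  fps_sum A (fps_monom \o w).

Definition fiber (I : Type) (A : set I) (w : I -> monom) (m : monom) : set I :=
  A `&` [set i | w i = m].

Lemma gfE (I : choiceType) (A : set I) (w : I -> monom) m :
  gf A w m = \sum_(i \in fiber A w m) (1 : int).
Proof.
rewrite /gf /fps_sum /fiber fsbig_mkcondr; apply: eq_fsbigr => i _ /=.
rewrite /fps_monom eq_sym; case: eqP => wi; first by rewrite ifT// inE.
by rewrite ifF//; apply/negbTE/negP => /set_mem.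
Qed.

(** A pair (i, j) of total weight [m] determines the splitting (w i, v j) of [m], so the Cauchy
    product counts each such pair once. Fibers are kept finite because a sum with infinite support
    is 0 by convention. *)
Lemma gfM (I J : choiceType) (A : set I) (w : I -> monom) (B : set J) (v : J -> monom) :
  (forall m, finite_set (fiber A w m)) -> (forall m, finite_set (fiber B v m)) ->
  fps_mul (gf A w) (gf B v) =
  gf (A `*` B) (fun p => (w p.1 `+` v p.2)%mset).
Proof.
move=> finA finB; apply/funext => m; rewrite /fps_mul gfE.
transitivity (\sum_(p \in splits m)
    \sum_(q \in fiber A w p.1 `*` fiber B v p.2) (1 : int)).
  apply: eq_fsbigr => p _; rewrite !gfE mulr_fsuml -(@pair_fsbig _ _ _ _ _ _ _ (fun _ _ => 1))//.
  by apply: eq_fsbigr => i _; rewrite mul1r.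
rewrite fsbig_sigma; [|exact: finite_splits|by move=> p _; exact: finite_setX].
rewrite (@reindex_fsbig _ _ _ _ _ (fun q => ((w q.1, v q.2), q))
  (fiber (A `*` B) (fun p => (w p.1 `+` v p.2)%mset) m))//.
split.
- by move=> [i j] /= [[Ai Bj] wv].
- by move=> p q _ _ [].
- move=> [[a b] [i j]] /= [ab [[Ai wi] [Bj vj]]].
  by exists (i, j); [split=> //=; rewrite wi vj | rewrite /= wi vj].
Qed.

Lemma finite_fiberM (I J : choiceType) (A : set I) (w : I -> monom) (B : set J) (v : J -> monom) :
  (forall m, finite_set (fiber A w m)) -> (forall m, finite_set (fiber B v m)) ->
  forall m, finite_set (fiber (A `*` B) (fun p => (w p.1 `+` v p.2)%mset) m).
Proof.
move=> finA finB m.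
apply: (@sub_finite_set _ _ (\bigcup_(p in splits m) (fiber A w p.1 `*` fiber B v p.2))).
  by move=> [i j] /= [[Ai Bj] wv]; exists (w i, v j).
apply: bigcup_finite; first exact: finite_splits.
by move=> p _; exact: finite_setX.
Qed.

Lemma gf_bij (I J : choiceType) (A : set I) (w : I -> monom) (B : set J) (v : J -> monom)
    (f : I -> J) :
  set_bij A B f -> (forall i, A i -> v (f i) = w i) -> gf A w = gf B v.
Proof.
move=> fAB wf; apply/funext => m; rewrite /gf /fps_sum (@reindex_fsbig _ _ _ _ _ f A B _ fAB).
by apply: eq_fsbigr => i /set_mem Ai /=; rewrite wf.
Qed.

Lemma gf1 (I : choiceType) (i : I) (w : I -> monom) : gf [set i] w = fps_monom (w i).
Proof. by apply/funext => m; rewrite /gf /fps_sum fsbig_set1. Qed.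

Lemma fps_monomM a b : fps_mul (fps_monom a) (fps_monom b) = fps_monom (a `+` b)%mset.
Proof.
have E c : fps_monom c = gf [set tt] (fun=> c) by rewrite gf1.
rewrite (E a) (E b) gfM; do ?by move=> m; apply: finite_setIl; exact: finite_set1.
rewrite E; apply: (@gf_bij _ _ _ _ _ _ (fun=> tt)) => //.
by split=> // [[[] []] [[] []]|[] _] //; exists (tt, tt).
Qed.

Definition nsmul (n : nat) (a : monom) : monom := iter n (msetD a) mset0.

Lemma nsmulE n a j : nsmul n a j = (n * a j)%N.
Proof. by elim: n => [|n IH]; rewrite ?mset0E //= msetE2 IH mulSn. Qed.

Lemma nsmul_inj a : a != mset0 -> injective (nsmul^~ a).
Proof.
case: (mset_0Vmem a) => [->|[j ja] _ n p /(congr1 (fun c : monom => c j))]; first by rewrite eqxx.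
rewrite !nsmulE => /eqP; rewrite eqn_mul2r => /orP[|/eqP//].
by rewrite mset_eq0 ja.
Qed.

Lemma finite_fiber_geom a m : a != mset0 -> finite_set (fiber [set: nat] (nsmul^~ a) m).
Proof.
move=> a0; have [[n nm]|none] := pselect (exists n, nsmul n a = m).
  apply: (@sub_finite_set _ _ [set n]); last exact: finite_set1.
  by move=> p [_ /= pm]; apply: (nsmul_inj a0); rewrite pm.
apply: (@sub_finite_set _ _ set0); last exact: finite_set0.
by move=> p [_ /= pm]; apply: none; exists p.
Qed.

Lemma fps_mulI f g h : fps_mul f g = fps_one -> fps_mul f h = fps_one -> g = h.
Proof.
move=> fg fh; rewrite -[g]fps_mul1 -fh (fps_mulC f) -fps_mulA fg.
by rewrite fps_mulC fps_mul1.
Qed.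

(** Multiplication by 1 - a telescopes: a times the geometric series is its part with n > 0, which
    leaves the term n = 0. Inverses being unique, [xget] must pick this one. *)
Lemma fps_inv_geom a : a != mset0 ->
  fps_inv (fps_sub fps_one (fps_monom a)) = gf [set: nat] (nsmul^~ a).
Proof.
move=> a0.
have geom : fps_mul (fps_sub fps_one (fps_monom a)) (gf [set: nat] (nsmul^~ a)) = fps_one.
  rewrite fps_mulBl fps_mul1 -(gf1 tt (fun=> a)) gfM; last first.
  - by move=> m; exact: finite_fiber_geom.
  - by move=> m; apply: finite_setIl; exact: finite_set1.
  rewrite (@gf_bij _ _ _ _ [set n | (0 < n)%N] (nsmul^~ a) (fun p => p.2.+1)); last 2 first.
  - split=> //=; first by move=> [[] n] [[] p] _ _ /= [->].
    by move=> [//|n] _; exists (tt, n).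
  - by move=> [[] n].
  apply/funext => m; rewrite /fps_sub !gfE.
  rewrite (_ : fiber setT _ m = fiber [set 0%N] (nsmul^~ a) m `|`
    fiber [set n | (0 < n)%N] (nsmul^~ a) m); last first.
    apply/seteqP; split=> [n [_ /= nm]|n [[_ nm]|[_ nm]]] //.
    by case: n nm => [|n] nm; [left|right].
  rewrite fsbigU0 ?addrK.
  - by rewrite -gfE gf1.
  - by apply: finite_setIl; exact: finite_set1.
  - apply: (@sub_finite_set _ _ _ _ (@finite_fiber_geom a m a0)).
    by move=> n [_ nm].
  - by move=> n [[/= -> _] [] ].
by apply: xget_unique => // h ah; exact: (fps_mulI ah geom).
Qed.

(** * Truncation to finitely many variables *)

Definition vars_lt (k : nat) (m : monom) := forall j, (k <= j)%N -> m j = 0%N.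

(** This is agreement after setting every variable of index at least [k] to 0. *)
Definition eq_lt (k : nat) (f g : fps) := forall m, vars_lt k m -> f m = g m.

Lemma eq_ltM k f f' g g' : eq_lt k f f' -> eq_lt k g g' ->
  eq_lt k (fps_mul f g) (fps_mul f' g').
Proof.
move=> ff' gg' m mk; apply: eq_fsbigr => -[a b] /set_mem /= ab.
rewrite ff' ?gg'// => j /mk; rewrite -ab msetE2 => /eqP.
  by rewrite addn_eq0 => /andP[_ /eqP].
by rewrite addn_eq0 => /andP[/eqP].
Qed.

Lemma eq_lt_prod (I : eqType) k (r : seq I) (F G : I -> fps) :
  (forall i, i \in r -> eq_lt k (F i) (G i)) ->
  eq_lt k (\big[fps_mul/fps_one]_(i <- r) F i) (\big[fps_mul/fps_one]_(i <- r) G i).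
Proof.
elim: r => [|i r IH] FG; first by rewrite !big_nil.
rewrite !big_cons; apply: eq_ltM; first by apply: FG; rewrite mem_head.
by apply: IH => j jr; apply: FG; rewrite in_cons jr orbT.
Qed.

Definition pair_geom (p : nat * nat) : fps :=
  fps_inv (fps_sub fps_one (fps_mul (fps_var p.1) (fps_var p.2))).

Definition pair_monom (p : nat * nat) : monom := ([mset p.1] `+` [mset p.2])%mset.

Lemma pair_monomE p j : pair_monom p j = ((j == p.1) + (j == p.2))%N.
Proof. by rewrite msetE2 !msetnE; do 2!case: (j == _). Qed.

Lemma pair_monom_neq0 p : pair_monom p != mset0.
Proof.
apply/eqP => /(congr1 (fun c : monom => c p.1)).
by rewrite /= pair_monomE eqxx mset0E.
Qed.

Lemma pair_geomE p : pair_geom p = gf [set: nat] (nsmul^~ (pair_monom p)).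
Proof. by rewrite /pair_geom /fps_var fps_monomM fps_inv_geom// pair_monom_neq0. Qed.

Lemma pair_geom_one k p : (p.1 < p.2)%N -> (k <= p.2)%N -> eq_lt k (pair_geom p) fps_one.
Proof.
move=> p12 kp m mk; rewrite pair_geomE gfE.
have -> : fps_one = gf [set 0%N] (nsmul^~ (pair_monom p)) by rewrite gf1.
rewrite gfE; apply: eq_fsbigl; apply/seteqP; split=> n [_ /= nm]; split=> //=.
have := mk _ kp; rewrite -nm nsmulE pair_monomE eqxx addn1 => /eqP.
by rewrite muln_eq0 orbF => /eqP.
Qed.

(** Passing to [k.+1] puts the new factors in front, here and in [pairs_lt], so that exponent lists
    grow by a cons in [row_pieri] and by a concatenation in [ssot_exponents_tableau]. *)
Fixpoint row_pairs (j k : nat) : seq (nat * nat) :=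
  if k is k'.+1 then (k', j) :: row_pairs j k' else [::].

Fixpoint pairs_lt (k : nat) : seq (nat * nat) :=
  if k is k'.+1 then row_pairs k' k' ++ pairs_lt k' else [::].

Lemma mem_row_pairs j k p : (p \in row_pairs j k) = (p.1 < k)%N && (p.2 == j).
Proof.
elim: k => [|k IH] //=; rewrite in_cons IH {IH}; case: p => p1 p2 /=.
by rewrite xpair_eqE ltnS (leq_eqVlt p1) andb_orl.
Qed.

Lemma mem_pairs_lt k p : (p \in pairs_lt k) = (p.1 < p.2 < k)%N.
Proof.
elim: k => [|k IH] /=; first by rewrite ltn0 andbF.
rewrite mem_cat mem_row_pairs IH {IH}; case: p => p1 p2 /=.
by rewrite ltnS (leq_eqVlt p2); case: eqP => [->|_] /=; rewrite ?ltnn ?andbF ?orbF.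
Qed.

Lemma row_pairs_uniq j k : uniq (row_pairs j k).
Proof. by elim: k => //= k ->; rewrite mem_row_pairs ltnn. Qed.

Lemma pairs_lt_uniq k : uniq (pairs_lt k).
Proof.
elim: k => //= k IH; rewrite cat_uniq row_pairs_uniq IH andbT /=.
apply/hasPn => p; rewrite mem_pairs_lt mem_row_pairs => /andP[_ pk].
by rewrite negb_and (ltn_eqF pk) orbT.
Qed.

(** A factor with [p.2] at least [k] truncates to 1, so all finite partial products that contain
    [pairs_lt k] have the same coefficient at [m]. *)
Lemma fps_prod_pair_geom k :
  eq_lt k (fps_prod [set p : nat * nat | (p.1 < p.2)%N] pair_geom)
    (\big[fps_mul/fps_one]_(p <- pairs_lt k) pair_geom p).
Proof.
move=> m mk; set c := RHS.
pose B0 : {fset nat * nat} := seq_fset tt (pairs_lt k).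
have stable (B : {fset nat * nat}) : [set` B0] `<=` [set` B] ->
    [set` B] `<=` [set p : nat * nat | (p.1 < p.2)%N] ->
    (\big[fps_mul/fps_one]_(p <- B) pair_geom p) m = c.
  move=> B0B BA.
  rewrite (@eq_lt_prod _ k _ _
    (fun p : nat * nat => if (p.2 < k)%N then pair_geom p else fps_one))//.
    have Bk : perm_eq [seq p <- B | (p.2 < k)%N] (pairs_lt k).
      apply: uniq_perm; rewrite ?filter_uniq ?pairs_lt_uniq ?fset_uniq// => p.
      rewrite mem_filter mem_pairs_lt; apply/andP/andP => [[pk pB]|[p12 pk]].
        by split=> //; exact: BA.
      by split=> //; apply: B0B; rewrite /= seq_fsetE mem_pairs_lt p12.
    by rewrite -big_mkcond -big_filter (perm_big _ Bk).
  move=> p pB; case: ltnP => // kp; apply: pair_geom_one => //; exact: BA.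
have B0A : [set` B0] `<=` [set p : nat * nat | (p.1 < p.2)%N].
  by move=> p; rewrite /= seq_fsetE mem_pairs_lt => /andP[].
apply: xget_unique; first by exists B0.
(* Another stable value [y], attained from [B1] on, is compared with [c] on the union of [B0] and
   [B1]. *)
move=> y [B1 B1A] yB1; rewrite -(yB1 (B0 `|` B1)%fset) ?stable//.
- by move=> p pB; rewrite /= in_fsetU pB.
- by move=> p; rewrite /= in_fsetU => /orP[/B0A|/B1A].
- by move=> p pB; rewrite /= in_fsetU pB orbT.
- by move=> p; rewrite /= in_fsetU => /orP[/B0A|/B1A].
Qed.

(** The list [e] picks one term from each geometric factor indexed by [r]. Every set weighted in
    this way imposes equal lengths. *)
Fixpoint exp_monom (r : seq (nat * nat)) (e : seq nat) : monom :=
  match r, e with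
  | p :: r', n :: e' => (nsmul n (pair_monom p) `+` exp_monom r' e')%mset
  | _, _ => mset0
  end.

Lemma exp_monom_cat r1 r2 e1 e2 : size e1 = size r1 ->
  exp_monom (r1 ++ r2) (e1 ++ e2) = (exp_monom r1 e1 `+` exp_monom r2 e2)%mset.
Proof.
elim: r1 e1 => [|p r1 IH] [|n e1] //=; first by rewrite mset0D.
by case=> /IH ->; rewrite msetDA.
Qed.

(** Expanding the product factor by factor uses [gfM], which needs finite fibers for the tail;
    finiteness is therefore carried through the same induction. *)
Lemma gf_exponents r :
  (forall m, finite_set (fiber [set e | size e = size r] (exp_monom r) m)) /\
  gf [set e | size e = size r] (exp_monom r) =
    \big[fps_mul/fps_one]_(p <- r) pair_geom p.
Proof.
elim: r => [|p r [fin IH]].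
  have -> : [set e : seq nat | size e = size (Nil (nat * nat))] = [set [::]].
    by apply/seteqP; split=> [[]|? ->].
  split; first by move=> m; apply: finite_setIl; exact: finite_set1.
  by rewrite gf1 big_nil.
pose h (q : nat * seq nat) := q.1 :: q.2.
have hbij : set_bij ([set: nat] `*` [set e | size e = size r])
    [set e | size e = size (p :: r)] h.
  split=> [[n e] [_ /= ->] //|[n e] [n' e'] _ _ [-> ->] //|[|n e] //= [er]].
  by exists (n, e).
split=> [m|]; last first.
  rewrite big_cons -IH pair_geomE gfM//; last first.
    by move=> m; apply: finite_fiber_geom; exact: pair_monom_neq0.
  by apply/esym/(gf_bij hbij) => -[n e].
have finp := finite_fiberM (fun m' => finite_fiber_geom m' (pair_monom_neq0 p)) fin m.
apply: (@sub_finite_set _ _ (h @` _) _ (finite_image h finp)).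
by move=> [|n e] [] //= [er] em; exists (n, e).
Qed.

Local Open Scope nat_scope.

(** * Partitions and the local rule *)

(** Weights are exponent functions rather than multisets, so that they add and compare pointwise.
    Both maps are kept, which makes inversion and composition immediate. *)
Definition equidist (I J : Type) (A : set I) (w : I -> nat -> nat)
    (B : set J) (v : J -> nat -> nat) : Prop :=
  exists f g,
    (forall a, A a -> [/\ B (f a), g (f a) = a & v (f a) =1 w a]) /\
    (forall b, B b -> A (g b) /\ f (g b) = b).

Lemma equidist_sym I J (A : set I) w (B : set J) v : equidist A w B v -> equidist B v A w.
Proof.
move=> [f [g [fP gP]]]; exists g, f; split.
  by move=> b /gP[Ab fg]; split=> // j; have [_ _ /(_ j)] := fP _ Ab; rewrite fg.
by move=> a /fP[].
Qed.

Lemma equidist_trans I J K (B : set J) v (A : set I) w (C : set K) u :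
  equidist A w B v -> equidist B v C u -> equidist A w C u.
Proof.
move=> [f [g [fP gP]]] [f' [g' [fP' gP']]].
exists (f' \o f), (g \o g'); split=> /= [a /fP[Bf gf wf]|c /gP'[/gP[Ag fg] fg']].
  by have [? -> wf'] := fP' _ Bf; split=> // j; rewrite wf' wf.
by rewrite fg.
Qed.

(** This lets a bijection act on one component of a configuration while the rest, [k], stays fixed
    and contributes the weight [u]. The axiom of choice collects the bijections into a family. *)
Lemma equidist_dep (K I J : Type) (A : K -> set I) w (B : K -> set J) v :
  (forall k, equidist (A k) (w k) (B k) (v k)) ->
  forall (P : K -> Prop) (u : K -> nat -> nat),
  equidist [set p | P p.1 /\ A p.1 p.2] (fun p j => u p.1 j + w p.1 p.2 j)
      [set p | P p.1 /\ B p.1 p.2] (fun p j => u p.1 j + v p.1 p.2 j).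
Proof.
move=> AB P u; have [f /choice[g fg]] := choice AB.
exists (fun p => (p.1, f p.1 p.2)), (fun p => (p.1, g p.1 p.2)).
split=> -[k a] /= [Pk]; have [fP gP] := fg k.
  by move=> /fP[Bf -> wf]; split=> // j; rewrite wf.
by move=> /gP[Ag ->].
Qed.

Lemma noninc_homo (p : nat -> nat) : (forall r, p r.+1 <= p r) ->
  forall i j, i <= j -> p j <= p i.
Proof.
move=> noninc i; elim=> [|j IH]; first by rewrite leqn0 => /eqP ->.
by rewrite leq_eqVlt => /orP[/eqP -> //|/IH]; apply: leq_trans.
Qed.

Lemma part_noninc (lam : intpart) r : part lam r.+1 <= part lam r.
Proof.
rewrite /part; case: (ltnP r.+1 (size lam)) => [lt|ge]; last by rewrite nth_default.
have /andP[srt _] := valP lam.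
by move/(sortedP 0): srt => /(_ r lt).
Qed.

Lemma part_default (lam : intpart) r : size lam <= r -> part lam r = 0.
Proof. exact: nth_default. Qed.

Lemma part_pos (lam : intpart) r : (0 < part lam r) = (r < size lam).
Proof.
apply/idP/idP => [|rlam]; first by apply: contraLR; rewrite -!leqNgt => /part_default ->.
have /andP[_ n0] := valP lam; rewrite lt0n; apply: contra n0 => /eqP <-.
exact: mem_nth.
Qed.

Lemma intpart_eq (lam mu : intpart) : part lam =1 part mu -> lam = mu.
Proof.
move=> e; apply: val_inj; apply: (@eq_from_nth _ 0) => [|r _]; last exact: e.
apply/eqP; rewrite eqn_leq; apply/andP; split; rewrite leqNgt -part_pos.
  by rewrite e part_default.
by rewrite -e part_default.
Qed.

Definition mkpart (p : nat -> nat) (N : nat) : intpart :=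
  insubd empty_partition [seq x <- mkseq p N | 0 < x].

(** In a nonincreasing list the zeros form a tail, so filtering them out shifts no row. *)
Lemma part_mkpart p N : (forall r, p r.+1 <= p r) -> p N = 0 ->
  part (mkpart p N) =1 p.
Proof.
move=> noninc pN r.
have mono := noninc_homo noninc.
have srt : sorted geq (mkseq p N).
  apply: (homo_sorted (e := leq)); last exact: iota_sorted.
  by move=> i j ij; exact: mono.
rewrite /part /mkpart /= insubdK; last first.
  rewrite unfold_in /= /is_partition mem_filter ltnn andbT.
  by apply: sorted_filter srt => x y z; rewrite /geq /=; lia.
have nthf s : sorted geq s -> nth 0 [seq x <- s | 0 < x] r = nth 0 s r.
  elim: s r => [|x s IH] r //=; case: x => [|x] /= xs; last first.
    by case: r => //= r; apply: IH; exact: path_sorted xs.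
  have s0 y : y \in s -> y = 0.
    have /allP s0 : all (geq 0) s by apply: order_path_min xs => ? ? ?; rewrite /geq /=; lia.
    by move=> /s0; rewrite /geq /=; lia.
  rewrite (@eq_in_filter _ _ pred0) ?filter_pred0 => [|y /s0 -> //].
  rewrite nth_nil; case: r => //= r; case: (ltnP r (size s)) => rs; last by rewrite nth_default.
  by rewrite (s0 _ (mem_nth 0 rs)).
rewrite nthf//; case: (ltnP r N) => rN; first by rewrite nth_mkseq.
by rewrite nth_default ?size_mkseq//; have := mono _ _ rN; rewrite pN; lia.
Qed.

Definition psize (lam : intpart) : nat := sumn lam.

Lemma psizeE (lam : intpart) N : size lam <= N -> psize lam = \sum_(r < N) part lam r.
Proof.
move=> lamN; rewrite /psize sumnE (big_nth 0) big_mkord.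
rewrite (big_ord_widen N (fun r => nth 0 lam r) lamN) big_mkcond /=.
by apply: eq_bigr => r _; case: ltnP => // ?; rewrite part_default.
Qed.

(** Row-wise form of containment with a horizontal strip as difference; see [interlaceP]. *)
Definition interlace (lam mu : intpart) : Prop :=
  forall r, part mu r <= part lam r /\ part lam r.+1 <= part mu r.

Lemma interlace_refl lam : interlace lam lam.
Proof. by move=> r; split=> //; exact: part_noninc. Qed.

Lemma interlace_size (lam mu : intpart) : interlace lam mu -> size mu <= size lam.
Proof.
move=> lm; rewrite leqNgt -part_pos; apply/negP => m0.
by have := (lm (size lam)).1; rewrite (part_default (leqnn _)) leqNgt m0.
Qed.

Lemma interlace_psize lam mu : interlace lam mu ->
  psize lam = psize mu + \sum_(r < size lam) (part lam r - part mu r).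
Proof.
move=> lm; rewrite (psizeE (leqnn _)) (psizeE (interlace_size lm)) -big_split /=.
by apply: eq_bigr => r _; have [? _] := lm r; rewrite subnKC.
Qed.

Lemma interlaceP lam mu :
  (part_sub mu lam /\ horizontal_strip lam mu) <-> interlace lam mu.
Proof.
split=> [[sub hs] r|lm]; last split.
- have subr i : part mu i <= part lam i.
    rewrite leqNgt; apply/negP => lt; have := sub (i, part lam i) lt.
    by rewrite /diagram /= ltnn.
  split=> //; rewrite leqNgt; apply/negP => lt.
  (* If row [r.+1] of [lam] were longer than row [r] of [mu], the column of index [part mu r] would
     meet the strip in both rows. *)
  have := hs r r.+1 (part mu r); rewrite /skew_diagram /diagram /= => h.
  suff : r = r.+1 by lia.
  by apply: h; have := part_noninc lam r; have := part_noninc mu r; lia.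
- by move=> [r c]; rewrite /diagram /=; have [] := lm r; lia.
- suff h r r' c : r < r' -> skew_diagram lam mu (r, c) -> skew_diagram lam mu (r', c) -> False.
    move=> r r' c rc r'c; case: (ltngtP r r') => // rr'.
      by case: (h _ _ _ rr' rc r'c).
    by case: (h _ _ _ rr' r'c rc).
  rewrite /skew_diagram /diagram /= => rr' [_ muc] [lamc _].
  by have := noninc_homo (@part_noninc lam) rr'; have [_] := lm r; lia.
Qed.

Lemma interlace0 mu : interlace empty_partition mu -> mu = empty_partition.
Proof.
move=> /interlace_size; rewrite leqn0 => /nilP mu0; exact: val_inj.
Qed.

(** Row [r.+1] of [nu] is paired with row [r] of [beta], and a maximum plus a minimum is the plain
    sum; only the unpaired row 0 of [nu] contributes the extra [n]. *)
Lemma psize_local (mu alpha nu beta : intpart) n N :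
  size mu <= N -> size alpha <= N ->
  part nu 0 = n + maxn (part mu 0) (part alpha 0) ->
  (forall r, part nu r.+1 + part beta r =
     maxn (part mu r.+1) (part alpha r.+1) + minn (part mu r) (part alpha r)) ->
  psize nu + psize beta = n + psize mu + psize alpha.
Proof.
move=> muN alN nu0 nuS.
have nuN : size nu <= N.+1.
  rewrite leqNgt -part_pos -leqNgt; have := nuS N.
  by rewrite (@part_default mu N.+1) ?(@part_default alpha N.+1) ?(part_default muN); lia.
have beN : size beta <= N.+1.
  rewrite leqNgt -part_pos -leqNgt; have := nuS N.+1.
  by rewrite (@part_default mu N.+2) ?(@part_default alpha N.+2)
     ?(@part_default mu N.+1); lia.
have beN0 : part beta N = 0.
  by have := nuS N; rewrite (@part_default mu N.+1) ?(@part_default alpha N.+1)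
     ?(part_default muN); lia.
rewrite (psizeE nuN) (psizeE beN) (@psizeE mu N.+1) ?(@psizeE alpha N.+1); try lia.
rewrite big_ord_recl nu0 /= [X in _ + X = _]big_ord_recr /= beN0 addn0.
have nube : \sum_(i < N) part nu (lift ord0 i) + \sum_(i < N) part beta i =
    \sum_(i < N) maxn (part mu i.+1) (part alpha i.+1) +
    \sum_(i < N) minn (part mu i) (part alpha i).
  by rewrite -!big_split; apply: eq_bigr => r _; exact: nuS.
have maxE : \sum_(i < N.+1) maxn (part mu i) (part alpha i) =
   maxn (part mu 0) (part alpha 0) + \sum_(i < N) maxn (part mu i.+1) (part alpha i.+1).
  by rewrite big_ord_recl.
have minE : \sum_(i < N.+1) minn (part mu i) (part alpha i) =
   \sum_(i < N) minn (part mu i) (part alpha i).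
  by rewrite big_ord_recr /= (part_default muN) min0n addn0.
have : \sum_(i < N.+1) maxn (part mu i) (part alpha i) +
    \sum_(i < N.+1) minn (part mu i) (part alpha i) =
    \sum_(i < N.+1) part mu i + \sum_(i < N.+1) part alpha i.
  by rewrite -!big_split; apply: eq_bigr => r _ /=; lia.
move: nube maxE minE.
set s1 := \sum_(i < N) part nu _; set s2 := \sum_(i < N) part beta _.
set s3 := \sum_(i < N) maxn _ _.
set s4 := \sum_(i < N) minn _ _.
set s5 := \sum_(i < N.+1) maxn _ _; set s6 := \sum_(i < N.+1) minn _ _.
set s7 := \sum_(i < N.+1) part mu _; set s8 := \sum_(i < N.+1) part alpha _.
lia.
Qed.

(* The toggle of the local rule: row r.+1 of nu and row r of beta both range over
   the interval between these max and min, which is reflected; row 0 of nu is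
   unbounded above and its excess is recorded by an exponent. *)
Definition swap_row (mu alpha : intpart) (p : nat -> nat) (r : nat) : nat :=
  maxn (part mu r.+1) (part alpha r.+1) + minn (part mu r) (part alpha r) - p r.

(** Going up from [mu] to [nu] and down to [alpha] is traded for going down from [mu] to [beta] and
    up to [alpha]. By [psize_local], |nu| - |alpha| = n + (|mu| - |beta|) and |nu| - |mu| = n +
    (|alpha| - |beta|), so the excess n carries both weights: it is the exponent in 1/(1 - y z). *)
Lemma local_rule (mu alpha : intpart) (y z : nat -> nat) :
  equidist [set nu | interlace nu mu /\ interlace nu alpha]
      (fun nu j => (psize nu - psize alpha) * y j + (psize nu - psize mu) * z j)
      [set p | interlace mu p.2 /\ interlace alpha p.2]
      (fun p j => p.1 * (y j + z j) + (psize mu - psize p.2) * y j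
                  + (psize alpha - psize p.2) * z j).
Proof.
(* Both [mu] and [alpha] vanish from row [N] on, so toggling down gives at most [N] rows, and
   toggling up at most [N.+1] because of the new row 0. *)
pose N := size mu + size alpha.
have muN : size mu <= N by rewrite leq_addr.
have alN : size alpha <= N by rewrite leq_addl.
have muN0 := part_default muN; have alN0 := part_default alN.
have muN1 : part mu N.+1 = 0 by apply: part_default; lia.
have alN1 : part alpha N.+1 = 0 by apply: part_default; lia.
pose max0 := maxn (part mu 0) (part alpha 0).
pose down (nu : intpart) := mkpart (swap_row mu alpha (fun r => part nu r.+1)) N.
pose up_row n (beta : intpart) r :=
  if r is r'.+1 then swap_row mu alpha (part beta) r' else n + max0.
pose up n beta := mkpart (up_row n beta) N.+1.
have downE nu : interlace nu mu -> interlace nu alpha ->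
    part (down nu) =1 swap_row mu alpha (fun r => part nu r.+1).
  move=> numu nual; apply: part_mkpart => [r|]; last by rewrite /swap_row; lia.
  rewrite /swap_row; have := numu r; have := nual r.
  by have := numu r.+1; have := nual r.+1; have := numu r.+2; have := nual r.+2; lia.
have upE n beta : interlace mu beta -> interlace alpha beta ->
    part (up n beta) =1 up_row n beta.
  move=> mube albe; apply: part_mkpart => [r|]; last by rewrite /= /swap_row; lia.
  case: r => [|r] /=; rewrite /swap_row /max0.
    by have := mube 0; have := albe 0; lia.
  by have := mube r; have := albe r; have := mube r.+1; have := albe r.+1; lia.
exists (fun nu => (part nu 0 - max0, down nu)), (fun p => up p.1 p.2); split.
  move=> nu [numu nual]; have dE := downE nu numu nual.
  have mube : interlace mu (down nu).
    move=> r; rewrite dE /swap_row; have := numu r; have := nual r.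
    by have := numu r.+1; have := nual r.+1; lia.
  have albe : interlace alpha (down nu).
    move=> r; rewrite dE /swap_row; have := numu r; have := nual r.
    by have := numu r.+1; have := nual r.+1; lia.
  have [nu0 nual0] := (numu 0, nual 0).
  have sz : psize nu + psize (down nu) = part nu 0 - max0 + psize mu + psize alpha.
    apply: (@psize_local mu alpha nu (down nu) _ N) => //; first by rewrite -/max0 /max0; lia.
    move=> r; rewrite dE /swap_row; have := numu r; have := nual r.
    by have := numu r.+1; have := nual r.+1; lia.
  split=> //.
    apply: intpart_eq => r; rewrite upE//; case: r => [|r] /=; first by rewrite /max0; lia.
    rewrite {1}/swap_row dE /swap_row; have := numu r; have := nual r.
    by have := numu r.+1; have := nual r.+1; lia.
  move=> j /=; have := interlace_psize numu; have := interlace_psize nual.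
  have := interlace_psize mube; have := interlace_psize albe => s1 s2 s3 s4.
  have -> : psize nu - psize alpha = part nu 0 - max0 + (psize mu - psize (down nu)) by lia.
  have -> : psize nu - psize mu = part nu 0 - max0 + (psize alpha - psize (down nu)) by lia.
  by rewrite !mulnDl mulnDr; lia.
move=> [n beta] /= [mube albe]; have uE := upE n beta mube albe.
have upmu : interlace (up n beta) mu.
  move=> r; rewrite !uE; case: r => [|r] /=; rewrite /swap_row /max0.
    by have := mube 0; have := albe 0; lia.
  by have := mube r; have := albe r; have := mube r.+1; have := albe r.+1; lia.
have upal : interlace (up n beta) alpha.
  move=> r; rewrite !uE; case: r => [|r] /=; rewrite /swap_row /max0.
    by have := mube 0; have := albe 0; lia.
  by have := mube r; have := albe r; have := mube r.+1; have := albe r.+1; lia.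
split=> //; congr (_, _); first by rewrite uE /= addnK.
apply: intpart_eq => r; rewrite downE// {1}/swap_row uE /= /swap_row.
by have := mube r; have := albe r; lia.
Qed.

(** * Tableaux and oscillating tableaux *)

Local Notation row T r := (nth [::] T r).

Definition tableau_lt (k : nat) (lam : intpart) : set (seq (seq nat)) :=
  [set T | is_ssyt lam T /\ forall r, all (fun x => x < k) (row T r)].

Lemma is_ssyt_rows lam T : is_ssyt lam T <->
  [/\ size T = size lam,
      forall r, size (row T r) = part lam r,
      forall r, sorted leq (row T r)
    & forall r c, c < part lam r.+1 -> nth 0 (row T r) c < nth 0 (row T r.+1) c].
Proof.
split=> [[shp srt col]|[szT szr srt col]].
  have szr r : size (row T r) = part lam r.
    rewrite /part -shp; case: (ltnP r (size T)) => rT; first by rewrite (nth_map [::]).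
    by rewrite !nth_default// size_map.
  split=> //; first by rewrite -shp size_map.
    move=> r; case: (ltnP r (size T)) => rT; last by rewrite nth_default.
    by apply: (allP srt); exact: mem_nth.
  by move=> r c; rewrite -szr; exact: col.
split.
- apply: (@eq_from_nth _ 0); first by rewrite size_map.
  by move=> r; rewrite size_map => rT; rewrite (nth_map [::])// szr.
- by apply/(all_nthP [::]) => r _; exact: srt.
- by move=> r c; rewrite szr; exact: col.
Qed.

Lemma sorted_split_max k s : sorted leq s -> all (fun x => x < k.+1) s ->
  s = [seq x <- s | x < k] ++ nseq (size s - size [seq x <- s | x < k]) k.
Proof.
elim: s => [|x s IH] //= xs /andP[xk sk].
have ss := path_sorted xs; case: ltnP => [_|kx] /=; first by rewrite subSS -IH.
have {xk kx} xk : x = k by lia.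
have smk y : y \in s -> y = k.
  move=> ys; have := allP sk _ ys; have := order_path_min leq_trans xs.
  by move=> /allP/(_ _ ys); rewrite xk; lia.
rewrite (@eq_in_filter _ _ pred0) ?filter_pred0 /= => [|y /smk ->]; last by rewrite ltnn.
by rewrite xk -(all_pred1P _ _ (introT allP (fun y ys => introT eqP (smk y ys)))).
Qed.

Lemma sorted_cat_max k s n : sorted leq s -> all (fun x => x < k) s ->
  sorted leq (s ++ nseq n k).
Proof.
elim: s => [|x s IH] /= xs; first by case: n => //= n _; elim: n => //= n ->; rewrite leqnn.
move=> /andP[xk sk]; have := IH (path_sorted xs) sk.
case: s xs {IH} sk => [|y s] /=; last by move=> /andP[-> _] _ ->.
by move=> _ _; case: n => //= n ->; rewrite ltnW.
Qed.

Lemma count_flatten_rows (T : seq (seq nat)) N j : size T <= N ->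
  count_mem j (flatten T) = \sum_(r < N) count_mem j (row T r).
Proof.
move=> TN; rewrite count_flatten sumnE big_map (big_nth [::]) big_mkord.
rewrite (big_ord_widen N (fun r => count_mem j (row T r)) TN) big_mkcond /=.
by apply: eq_bigr => r _; case: ltnP => // ?; rewrite nth_default.
Qed.

Definition tab_weight (T : seq (seq nat)) (j : nat) : nat := count_mem j (flatten T).

(** The entries equal to [k] end their rows and form a horizontal strip; erasing them leaves a
    tableau with entries below [k], and refilling the strip recovers the original. *)
Lemma tableau_step k lam :
  equidist (tableau_lt k.+1 lam) tab_weight
      [set p | interlace lam p.1 /\ tableau_lt k p.1 p.2]
      (fun p j => (psize lam - psize p.1) * (j == k) + tab_weight p.2 j).
Proof.
pose cut s := [seq x <- s | x < k].
pose inner (T : seq (seq nat)) := mkpart (fun r => size (cut (row T r))) (size lam).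
pose strip T := mkseq (fun r => cut (row T r)) (size (inner T)).
pose fill (mu : intpart) T :=
  mkseq (fun r => row T r ++ nseq (part lam r - part mu r) k) (size lam).
have weight (mu : intpart) T : interlace lam mu -> size T = size mu ->
    tab_weight (fill mu T) =1 fun j => (psize lam - psize mu) * (j == k) + tab_weight T j.
  move=> lm szT j; rewrite /tab_weight (@count_flatten_rows _ (size lam)) ?size_mkseq//.
  rewrite (@count_flatten_rows T (size lam)) ?szT ?interlace_size//.
  rewrite (interlace_psize lm) addKn big_distrl -big_split /=; apply: eq_bigr => r _.
  by rewrite nth_mkseq// count_cat count_nseq /= eq_sym mulnC addnC.
have rowfill mu T r : interlace lam mu -> size T = size mu ->
    row (fill mu T) r = row T r ++ nseq (part lam r - part mu r) k.
  move=> lm szT; case: (ltnP r (size lam)) => rl; first by rewrite nth_mkseq.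
  rewrite nth_default ?size_mkseq// nth_default ?szT; last exact: leq_trans (interlace_size lm) rl.
  by rewrite part_default.
exists (fun T => (inner T, strip T)), (fun p => fill p.1 p.2); split.
  move=> T [/is_ssyt_rows[szT szr srt col] Tk].
  have split_row r : row T r = cut (row T r) ++ nseq (part lam r - size (cut (row T r))) k.
    by rewrite -szr; exact: sorted_split_max.
  have cut_le r : size (cut (row T r)) <= part lam r by rewrite -szr size_filter count_size.
  (* Otherwise, in the first column past the cut row [r], row [r] holds [k] and column strictness
     would force a larger entry below it. *)
  have cut_ge r : part lam r.+1 <= size (cut (row T r)).
    rewrite leqNgt; apply/negP => lt; have := col _ _ lt.
    rewrite {1}split_row nth_cat ltnn subnn nth_nseq.
    have -> : 0 < part lam r - size (cut (row T r)) by have := part_noninc lam r; lia.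
    have := allP (Tk r.+1) (nth 0 (row T r.+1) (size (cut (row T r)))).
    by rewrite mem_nth ?szr// => /(_ isT); lia.
  have innerE : part (inner T) =1 fun r => size (cut (row T r)).
    apply: part_mkpart => [r|]; first exact: leq_trans (cut_le _) (cut_ge _).
    by apply/eqP; rewrite -leqn0; apply: leq_trans (cut_le _) _; rewrite part_default.
  have lm : interlace lam (inner T) by move=> r; rewrite innerE.
  have rowstrip r : row (strip T) r = cut (row T r).
    case: (ltnP r (size (inner T))) => ri; first by rewrite nth_mkseq.
    rewrite nth_default ?size_mkseq//; apply/esym/size0nil.
    by rewrite -innerE part_default.
  have szs : size (strip T) = size (inner T) by rewrite size_mkseq.
  have fillK : fill (inner T) (strip T) = T.
    apply: (@eq_from_nth _ [::]); first by rewrite size_mkseq szT.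
    by move=> r _; rewrite rowfill// rowstrip innerE -split_row.
  split=> //=; last by move=> j; rewrite -weight// fillK.
  split=> //; split; last by move=> r; rewrite rowstrip filter_all.
  apply/is_ssyt_rows; split=> //.
  - by move=> r; rewrite rowstrip innerE.
  - by move=> r; rewrite rowstrip; apply: sorted_filter => //; exact: leq_trans.
  - move=> r c; rewrite innerE !rowstrip => cr.
    have cr' : c < size (cut (row T r)) by have := cut_le r.+1; have := cut_ge r; lia.
    have := @col r c; rewrite (split_row r) (split_row r.+1) !nth_cat cr cr'.
    by rewrite -!split_row; apply; apply: leq_trans cr (cut_le _).
move=> [mu T] /= [lm [/is_ssyt_rows[szT szr srt col] Tk]].
have rowE r := rowfill mu T r lm szT.
have cutE r : cut (row (fill mu T) r) = row T r.
  rewrite rowE /cut filter_cat (all_filterP (Tk r)) -[RHS]cats0; congr (_ ++ _).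
  by elim: (_ - _) => //= n ->; rewrite ltnn.
have innerE : inner (fill mu T) = mu.
  apply: intpart_eq => r; rewrite part_mkpart => [|i|] /=; rewrite !cutE !szr//.
    exact: part_noninc.
  by apply: part_default; exact: interlace_size.
split; last first.
  rewrite /strip innerE; congr (_, _); apply: (@eq_from_nth _ [::]); rewrite size_mkseq//.
  by move=> r rm; rewrite (nth_mkseq _ _ rm) cutE.
split; last first.
  move=> r; rewrite rowE all_cat; apply/andP; split.
    by apply: sub_all (Tk r) => x xk; exact: ltnW.
  by rewrite all_nseq ltnSn orbT.
apply/is_ssyt_rows; split.
- by rewrite size_mkseq.
- by move=> r; rewrite rowE size_cat size_nseq szr subnKC//; have [] := lm r.
- by move=> r; rewrite rowE sorted_cat_max.
- move=> r c cl; rewrite !rowE !nth_cat !szr.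
  have -> : c < part mu r by have [_] := lm r; exact: leq_trans.
  (* When the lower entry is a new [k], the upper one still lies in the old row [r], since row
     [r.+1] of [lam] is no longer than row [r] of [mu]; hence it is below [k]. *)
  case: (ltnP c (part mu r.+1)) => cm; first exact: col.
  rewrite nth_nseq ifT; last by lia.
  apply: (allP (Tk r)); rewrite mem_nth// szr; have [_] := lm r; exact: leq_trans.
Qed.

(* Removing a horizontal strip of weight x_l after building a tableau in
   x_0, ..., x_(k-1) produces the factors 1/(1 - x_i x_l), i < k. *)
Lemma row_pieri k l alpha :
  equidist [set p | interlace p.1 alpha /\ tableau_lt k p.1 p.2]
      (fun p j => (psize p.1 - psize alpha) * (j == l) + tab_weight p.2 j)
      [set p | size p.1 = k /\ tableau_lt k alpha p.2]
      (fun p j => exp_monom (row_pairs l k) p.1 j + tab_weight p.2 j).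
Proof.
elim: k alpha => [|k IH] alpha.
  have tab0 nu T : tableau_lt 0 nu T -> T = [::] /\ nu = empty_partition.
    move=> [/is_ssyt_rows[szT szr _ _] T0].
    have nu0 : size nu = 0.
      apply/eqP; rewrite -leqn0 leqNgt -part_pos -szr.
      by case: (row T 0) (T0 0).
    split; first by apply: size0nil; rewrite szT.
    by apply: val_inj; exact: size0nil.
  exists (fun p => ([::], p.2)), (fun p => (empty_partition, p.2)); split.
    move=> [nu T] /= [na Tn]; have [T0 nu0] := tab0 _ _ Tn; subst.
    have al0 := interlace0 na; subst.
    by split=> // j; rewrite subnn mul0n mset0E.
  move=> [c T] /= [/size0nil -> Ta]; have [T0 al0] := tab0 _ _ Ta; subst.
  by split=> //; split=> //; exact: interlace_refl.
have step := tableau_step k.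
(* Peel the entries [k] off the tableau: its shape [nu] is now reached from a smaller shape by
   adding a strip weighted by x_k. *)
apply: (equidist_trans (equidist_dep step (fun nu => interlace nu alpha)
  (fun nu j => (psize nu - psize alpha) * (j == l)))).
apply: (@equidist_trans _ _ _
  [set p : (intpart * seq (seq nat)) * intpart | tableau_lt k p.1.1 p.1.2 /\
     (interlace p.2 p.1.1 /\ interlace p.2 alpha)]
  (fun p j => tab_weight p.1.2 j +
     ((psize p.2 - psize alpha) * (j == l) + (psize p.2 - psize p.1.1) * (j == k)))).
  exists (fun p => (p.2, p.1)), (fun p => (p.2, p.1)); split=> [[nu [mu T]]|[[mu T] nu]] /=.
    by move=> [? [? ?]]; split=> // j /=; lia.
  by move=> [? [? ?]].
(* Exchange this addition with the removal weighted by x_l. The exponent that appears belongs to the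
   pair (k, l), the head of [row_pairs l k.+1]. *)
apply: (equidist_trans (equidist_dep (K := intpart * seq (seq nat))
  (fun q => @local_rule q.1 alpha (fun j => j == l) (fun j => j == k))
  (fun q => tableau_lt k q.1 q.2) (fun q j => tab_weight q.2 j))).
apply: (@equidist_trans _ _ _
  [set p : (nat * intpart) * (intpart * seq (seq nat)) | interlace alpha p.1.2 /\
     (interlace p.2.1 p.1.2 /\ tableau_lt k p.2.1 p.2.2)]
  (fun p j => (p.1.1 * ((j == l) + (j == k)) + (psize alpha - psize p.1.2) * (j == k)) +
     ((psize p.2.1 - psize p.1.2) * (j == l) + tab_weight p.2.2 j))).
  exists (fun p => (p.2, p.1)), (fun p => (p.2, p.1)); split=> -[[? ?] [? ?]] /=.
    by move=> [? [? ?]]; split=> // j /=; lia.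
  by move=> [? [? ?]].
(* The removal now acts directly on the smaller tableau, where the induction hypothesis absorbs
   it. *)
apply: (equidist_trans (equidist_dep (K := nat * intpart) (fun q => IH q.2)
  (fun q => interlace alpha q.2)
  (fun q j => q.1 * ((j == l) + (j == k)) + (psize alpha - psize q.2) * (j == k)))).
apply: (@equidist_trans _ _ _
  [set p : seq nat * (intpart * seq (seq nat)) | size p.1 = k.+1 /\
     (interlace alpha p.2.1 /\ tableau_lt k p.2.1 p.2.2)]
  (fun p j => exp_monom (row_pairs l k.+1) p.1 j +
     ((psize alpha - psize p.2.1) * (j == k) + tab_weight p.2.2 j))).
  exists (fun p => (p.1.1 :: p.2.1, (p.1.2, p.2.2))),
    (fun p => ((head 0 p.1, p.2.1), (behead p.1, p.2.2))); split.
    move=> [[n beta] [c T]] /= [? [sc ?]]; split=> //=; first by rewrite sc.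
    by move=> j; rewrite msetE2 nsmulE pair_monomE /=; lia.
  by move=> [[|n c] [beta T]] //= [[sc] [? ?]].
(* The remaining strip weighted by x_k is filled with entries [k], giving a tableau of shape
   [alpha]. *)
exact: (equidist_dep (fun c : seq nat => equidist_sym (step alpha)) (fun c => size c = k.+1)
  (fun c j => exp_monom (row_pairs l k.+1) c j)).
Qed.

Definition ssot_lt (k : nat) (lam : intpart) : set ssot_seq :=
  [set S | [/\ S.1 0 = empty_partition /\ S.2 0 = empty_partition,
     forall i, interlace (S.1 i) (S.2 i) /\ interlace (S.1 i.+1) (S.2 i)
   & forall i, k <= i -> S.1 i = lam /\ S.2 i = lam]].

Definition ssot_weight (S : ssot_seq) (j : nat) : nat :=
  (psize (S.1 j) - psize (S.2 j)) + (psize (S.1 j.+1) - psize (S.2 j)).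

(** The sequence is cut at index [k]: the shape [S.1 k] is repeated forever after to give a shorter
    SSOT, and [S.2 k] is recorded. Conversely, the recorded shape and then constant [lam] are
    appended. *)
Lemma ssot_step k lam :
  equidist (ssot_lt k.+1 lam) ssot_weight
      [set p : intpart * (intpart * ssot_seq) |
         interlace lam p.1 /\ (interlace p.2.1 p.1 /\ ssot_lt k p.2.1 p.2.2)]
      (fun p j => (psize lam - psize p.1) * (j == k) +
         ((psize p.2.1 - psize p.1) * (j == k) + ssot_weight p.2.2 j)).
Proof.
exists (fun S : ssot_seq => (S.2 k, (S.1 k,
    (fun i => if i <= k then S.1 i else S.1 k, fun i => if i < k then S.2 i else S.1 k)))),
  (fun p : intpart * (intpart * ssot_seq) =>
    (fun i => if i <= k then p.2.2.1 i else lam,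
     fun i => if i < k then p.2.2.2 i else if i == k then p.1 else lam)).
split.
  move=> [S S'] [/= [S0 S'0] SS' Sk].
  have [Sk1 S'k1] := Sk _ (leqnn _).
  split=> /=.
  - split; first by have [] := SS' k; rewrite Sk1.
    split; first by have [] := SS' k.
    split=> /=.
    + by split=> //; case: (posnP k) => [->|].
    + move=> i; case: (ltngtP i k) => [ik|ik|->]; rewrite ?(ltnW ik)//=.
      * by split; exact: interlace_refl.
      * by split; exact: interlace_refl.
    + by move=> i ki; rewrite ltnNge ki /=; case: ltngtP ki => // ->.
  - congr (_, _); apply/funext => i.
      by case: leqP => // ki; have [] := Sk i ki.
    case: (ltngtP i k) => [ik|ik|->] //=; first by have [] := Sk i ik.
  - move=> j; rewrite /ssot_weight /=.
    case: (ltngtP j k) => [jk|jk|->]; rewrite ?subnn ?muln0 ?muln1 ?add0n ?addn0//=.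
      have [-> ->] := Sk j jk; have [-> _] := Sk j.+1 (ltnW jk).
      by rewrite subnn.
    by rewrite Sk1; lia.
move=> [alpha [nu [S S']]] [/= la [na [/= [S0 S'0] SS' Sk]]].
have [Skk S'kk] := Sk _ (leqnn k).
split; last first.
  rewrite /= leqnn ltnn eqxx Skk; congr (_, (_, (_, _))); apply/funext => i.
    by case: leqP => // ki; have [] := Sk i (ltnW ki).
  by case: ltnP => // ki; have [] := Sk i ki.
split=> /=.
(* For [k] = 0 the appended [alpha] lands at index 0; it is empty because it is contained in the
   empty [nu]. *)
- split=> //; rewrite S'0; case: (posnP k) => // k0.
  by move: na; rewrite k0 /= -Skk k0 S0 => /interlace0.
- move=> i; case: (ltngtP i k) => [ik|ik|->]; rewrite ?(ltnW ik)//=.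
  + by split; exact: interlace_refl.
  + by rewrite Skk.
- by move=> i ki; rewrite leqNgt ki /= ltnNge (ltnW ki) /= gtn_eqF.
Qed.

Lemma ssot_exponents_tableau k lam :
  equidist (ssot_lt k lam) ssot_weight
      ([set e | size e = size (pairs_lt k)] `*` tableau_lt k lam)
      (fun p j => (exp_monom (pairs_lt k) p.1 `+` seq_mset (flatten p.2))%mset j).
Proof.
elim: k lam => [|k IH] lam.
  exists (fun _ => ([::], [::])), (fun _ => (fun _ => empty_partition, fun _ => empty_partition)).
  split=> [[S S'] [/= [S0 S'0] SS' Sk]|[e T] [/= /size0nil ->]].
    have [l0 _] := Sk 0 (leqnn _); have {l0 S0} l0 : lam = empty_partition by rewrite -l0.
    subst lam; split.
    - split=> //=; split; last by move=> r; rewrite nth_nil.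
      by apply/is_ssyt_rows; split=> // r; rewrite ?nth_nil /part ?nth_nil.
    - by congr (_, _); apply/funext => i; have [] := Sk i (leq0n _).
    - move=> j /=; rewrite msetE2 mset0E mset_seqE /ssot_weight /=.
      by have [-> ->] := Sk j (leq0n _); have [-> _] := Sk j.+1 (leq0n _); rewrite subnn.
  move=> [/is_ssyt_rows[szT szr _ _] T0].
  have l0 : size lam = 0.
    by apply/eqP; rewrite -leqn0 leqNgt -part_pos -szr; case: (row T 0) (T0 0).
  have {l0} szl : lam = empty_partition by apply: val_inj; exact: size0nil.
  split; last by rewrite (size0nil (s := T)) // szT szl.
  by split=> // i; rewrite ?szl//=; split; exact: interlace_refl.
apply: (equidist_trans (ssot_step k lam)).
apply: (equidist_trans (equidist_dep (fun alpha => equidist_dep IH (fun nu => interlace nu alpha)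
  (fun nu j => (psize nu - psize alpha) * (j == k))) (interlace lam)
  (fun alpha j => (psize lam - psize alpha) * (j == k)))).
apply: (@equidist_trans _ _ _
  [set p : (intpart * seq nat) * (intpart * seq (seq nat)) |
     (interlace lam p.1.1 /\ size p.1.2 = size (pairs_lt k)) /\
     (interlace p.2.1 p.1.1 /\ tableau_lt k p.2.1 p.2.2)]
  (fun p j => ((psize lam - psize p.1.1) * (j == k) + exp_monom (pairs_lt k) p.1.2 j) +
     ((psize p.2.1 - psize p.1.1) * (j == k) + tab_weight p.2.2 j))).
  exists (fun p => ((p.1, p.2.2.1), (p.2.1, p.2.2.2))),
    (fun p => (p.1.1, (p.2.1, (p.1.2, p.2.2)))); split.
    move=> [alpha [nu [e T]]] /= [la [na [se tT]]]; split=> // j /=.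
    by rewrite msetE2 mset_seqE -addnA (addnCA (exp_monom _ _ _)).
  by move=> [[alpha e] [nu T]] /= [[? ?] [? ?]].
(* The removal weighted by x_k passes through the tableau of shape [nu]; its exponents, indexed by
   [row_pairs k k], are then put in front of the old ones. *)
apply: (equidist_trans (equidist_dep (K := intpart * seq nat) (fun q => row_pieri k k q.1)
  (fun q => interlace lam q.1 /\ size q.2 = size (pairs_lt k))
  (fun q j => (psize lam - psize q.1) * (j == k) + exp_monom (pairs_lt k) q.2 j))).
have szrow l : size (row_pairs l k) = k by elim: k {IH} => //= n ->.
apply: (@equidist_trans _ _ _
  [set p : seq nat * (intpart * seq (seq nat)) | size p.1 = size (pairs_lt k.+1) /\
     (interlace lam p.2.1 /\ tableau_lt k p.2.1 p.2.2)]
  (fun p j => exp_monom (pairs_lt k.+1) p.1 j +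
     ((psize lam - psize p.2.1) * (j == k) + tab_weight p.2.2 j))).
  exists (fun p => (p.2.1 ++ p.1.2, (p.1.1, p.2.2))),
    (fun p => ((p.2.1, drop k p.1), (take k p.1, p.2.2))); split.
    move=> [[alpha e] [c T]] /= [[la se] [sc tT]]; split=> /=.
    - by rewrite !size_cat szrow sc se.
    - by rewrite drop_size_cat// take_size_cat.
    - move=> j; rewrite exp_monom_cat ?szrow// msetE2.
      by rewrite (addnC (exp_monom (row_pairs _ _) _ _)) addnACA (addnC (exp_monom _ _ _)).
  move=> [e [alpha T]] /=; rewrite size_cat szrow => -[se [la tT]].
  by rewrite cat_take_drop size_drop size_takel se ?addKn ?leq_addr.
(* The last strip, from [alpha] to [lam], becomes the entries [k] of the tableau. *)
have fin := equidist_dep (fun c : seq nat => equidist_sym (tableau_step k lam))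
  (fun c => size c = size (pairs_lt k.+1)) (fun c j => exp_monom (pairs_lt k.+1) c j).
apply: (equidist_trans fin).
exists id, id; split=> [[e T] /= [se tT]|[e T] /= [se tT]] //.
by split=> // j; rewrite msetE2 mset_seqE.
Qed.

(** * Passage to infinitely many variables *)

Lemma vars_lt_exists (m : monom) : exists k, vars_lt k m.
Proof.
exists (\max_(i <- finsupp m) i).+1 => j jk; apply: fsfun_dflt.
by apply/negP => jm; move: jk; rewrite ltnNge (leq_bigmax_seq _ jm).
Qed.

Definition tableau_monom (T : seq (seq nat)) : monom := seq_mset (flatten T).

(** A tableau is recovered by reshaping its flattened word, and that word is one of the finitely
    many permutations of [m]. *)
Lemma finite_fiber_tableau (A : set (seq (seq nat))) lam m :
  (forall T, A T -> is_ssyt lam T) -> finite_set (fiber A tableau_monom m).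
Proof.
move=> Alam; apply: (@sub_finite_set _ _
  (reshape lam @` [set` permutations (enum_mset m)])); last exact/finite_image/finite_seq.
move=> T [/Alam[shT _ _] /= Tm]; exists (flatten T); last by rewrite -shT flattenK.
by rewrite /= mem_permutations -Tm perm_sym perm_eq_seq_mset.
Qed.

Lemma schur_tableau_lt k lam :
  eq_lt k (schur lam) (gf (tableau_lt k lam) tableau_monom).
Proof.
move=> m mk; rewrite (_ : schur lam = gf [set T | is_ssyt lam T] tableau_monom)// !gfE.
apply: eq_fsbigl; apply/seteqP; split=> T [/= Tlam Tm]; last by case: Tlam.
split=> //; split=> // r; apply/allP => x xr; rewrite ltnNge; apply/negP => /mk.
rewrite -Tm mset_seqE => /count_memPn/negP; apply.
apply/flattenP; exists (nth [::] T r) => //; apply: mem_nth.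
by rewrite ltnNge; apply/negP => rT; move: xr; rewrite nth_default.
Qed.

Lemma interlace_eq lam mu : interlace lam mu -> psize lam - psize mu = 0 -> lam = mu.
Proof.
move=> lm; rewrite (interlace_psize lm) addKn => /eqP; rewrite sum_nat_eq0 => /forallP z.
apply: intpart_eq => r; have [mul _] := lm r; apply/eqP; rewrite eqn_leq mul andbT.
case: (ltnP r (size lam)) => rl; last by rewrite part_default.
by have := z (Ordinal rl); rewrite /= subn_eq0.
Qed.

Lemma ssot_multE S : (forall i, interlace (S.1 i) (S.2 i) /\ interlace (S.1 i.+1) (S.2 i)) ->
  ssot_mult S =1 ssot_weight S.
Proof.
move=> SS' j; have [i1 i2] := SS' j; rewrite /ssot_mult /ssot_weight /skew_size.
by rewrite (interlace_psize i1) (interlace_psize i2) !addKn.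
Qed.

(** A zero exponent makes both strips at that index empty. Hence the sequence is constant from [k]
    on, and the constant is its eventual value [lam]. *)
Lemma ssot_ltP k lam (m : monom) S : vars_lt k m ->
  (is_ssot lam S /\ m =1 ssot_mult S) <-> (ssot_lt k lam S /\ ssot_weight S =1 m).
Proof.
move=> mk; split.
  move=> [[S0 sub hs [N SN]] mS].
  have SS' i : interlace (S.1 i) (S.2 i) /\ interlace (S.1 i.+1) (S.2 i).
    by have [? ?] := sub i; have [? ?] := hs i; split; apply/interlaceP.
  have wS : ssot_weight S =1 m by move=> j; rewrite mS ssot_multE.
  split=> //; split=> // i ki.
  have const j : k <= j -> S.1 j = S.2 j /\ S.1 j.+1 = S.2 j.
    move=> kj; have := wS j; rewrite mk// /ssot_weight => /eqP.
    rewrite addn_eq0 => /andP[/eqP e1 /eqP e2]; have [i1 i2] := SS' j.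
    by split; apply: interlace_eq.
  have S1 d : S.1 (i + d) = S.1 i.
    elim: d => [|d IH]; first by rewrite addn0.
    have [e1 e2] := const (i + d) (leq_trans ki (leq_addr _ _)).
    by rewrite addnS e2 -e1.
  have Si : S.1 i = lam by rewrite -(S1 N); have [] := SN (i + N) (leq_addl _ _).
  by split=> //; have [<- _] := const i ki.
move=> [[S0 SS' Sk] wS]; split; last by move=> j; rewrite ssot_multE// wS.
split=> // [i|i|]; last by exists k.
  by have [/interlaceP[? _] /interlaceP[? _]] := SS' i.
by have [/interlaceP[_ ?] /interlaceP[_ ?]] := SS' i.
Qed.

Local Open Scope ring_scope.

(** An SSOT with monomial [m] has length the degree [n] of [m], so only the summand [ss_n lam n]
    contributes to this coefficient. *)
Lemma ssE lam m : ss lam m =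
  \sum_(S \in [set S | is_ssot lam S /\ m =1 ssot_mult S]) (1 : int).
Proof.
pose n := \big[addn/0%N]_(i \in [set: nat]) m i.
have len S : m =1 ssot_mult S -> ssot_length S = n.
  by move=> mS; apply: eq_fsbigr => i _; rewrite mS.
rewrite /ss /fps_sum -(@fsbig_widen _ _ _ _ [set n] setT)//; last first.
  move=> p [_ /= pn]; rewrite /ss_n /fps_sum; apply: fsbig1 => S [_ lenS].
  by rewrite /ssot_monom asboolF// => /len; rewrite lenS.
rewrite fsbig_set1 /ss_n /fps_sum.
rewrite -(@fsbig_widen _ _ _ _ [set S | is_ssot lam S /\ m =1 ssot_mult S]
   [set S | is_ssot lam S /\ ssot_length S = n]).
- by apply: eq_fsbigr => S /set_mem [_ mS]; rewrite /ssot_monom asboolT.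
- by move=> S [Slam mS]; split=> //; exact: len.
- by move=> S [[Slam _] nS]; rewrite /= /ssot_monom asboolF// => mS; apply: nS.
Qed.

Lemma equidist_gf (I J : choiceType) (A : set I) w (B : set J) (v : J -> monom) (m : monom) :
  equidist A w B (fun b j => v b j) ->
  \sum_(i \in [set i | A i /\ w i =1 m]) (1 : int) = gf B v m.
Proof.
move=> [f [g [fP gP]]]; rewrite gfE; apply/esym.
apply: (@reindex_fsbig _ _ _ _ _ f); split.
- move=> a [/fP[Bf _ wf] wm]; split=> //; apply/msetP => j.
  by rewrite wf wm.
- move=> a b /set_mem[/fP[_ ga _] _] /set_mem[/fP[_ gb _] _] fab.
  by rewrite -ga fab gb.
- move=> b [Bb vb]; have [Ag fg] := gP b Bb; exists (g b) => //; split=> // j.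
  by have [_ _ <-] := fP _ Ag; rewrite fg vb.
Qed.

Theorem theorem3p13 (lam : intpart) :
  ss lam =
  fps_mul
    (fps_prod [set p : nat * nat | (p.1 < p.2)%N]
       (fun p => fps_inv
          (fps_sub fps_one (fps_mul (fps_var p.1) (fps_var p.2)))))
    (schur lam).
Proof.
apply/funext => m; have [k mk] := vars_lt_exists m.
have [finE gfEk] := gf_exponents (pairs_lt k).
(* The coefficient at [m] only sees variables below [k], so both factors are replaced by their
   truncations, and their product counts pairs of an exponent list and a tableau. *)
rewrite (eq_ltM (@fps_prod_pair_geom k) (@schur_tableau_lt k lam) mk) -gfEk gfM//; last first.
  by move=> m'; apply: (@finite_fiber_tableau _ lam) => T [].
rewrite -(equidist_gf _ (ssot_exponents_tableau k lam)) ssE.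
by apply: eq_fsbigl; apply/seteqP; split=> S /(ssot_ltP _ _ mk).
Qed.
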